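(* Let $X=(X,d,\mu)$ be a Borel and Borel-regular metric measure space all of whose closed balls have positive and finite measure, and let $r\in(0,\infty)$. Suppose that for every $s>0$, $X$ is $s$-doubling and satisfies the property $(\star)_s$. Then the averaging operator $A_r : L^1(X)\to L^1(X)$ is compact if and only if $X$ is bounded.
   Context: $(X,d)$ is a metric space and $\mu$ is a measure on $X$ for which Borel sets are measurable. Borel-regular means that each subset of $X$ is contained in some Borel set with the same measure (so $\mu$ is regarded as an outer measure on all subsets). $B(x,s)$ denotes the closed ball $\{y\in X : d(x,y)\le s\}$. All closed balls ($x\in X$, $s>0$) satisfy $0<\mu(B(x,s))<\infty$. Averaging operator: for a function $f$ integrable on balls, $A_rf(x)=\frac{1}{\mu(B(x,r))}\int_{B(x,r)} f(y)\,d\mu(y)$. For $s>0$, $X$ is $s$-doubling if there exists $\gamma\ge 1$ such that $\mu(B(x,2s))\le\gamma\,\mu(B(x,s))$ for all $x\in X$. Property $(\star)_s$: for each $\epsilon>0$ there is $\delta\in(0,s)$ such that $\mu(B(x,s+\delta)\setminus B(x,s-\delta))<\epsilon$ for every $x\in X$. $L^1(X)$ is the (real) Lebesgue space of $\mu$-integrable functions. *)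

(* Defs.v *)
From HB Require Import structures.
From mathcomp Require Import all_boot all_order all_algebra.
From mathcomp Require Import all_classical all_reals all_analysis.
From mathcomp Require Import measurable_realfun.

Set Implicit Arguments.
Unset Strict Implicit.
Unset Printing Implicit Defensive.
Import Order.TTheory GRing.Theory Num.Theory.

Local Open Scope classical_set_scope.
Local Open Scope ring_scope.

(* The library's measurable types are pointed, so metric measure spaces are
   nonempty here. *)
#[short(type="pmetricType")]
HB.structure Definition PointedMetric (R : numDomainType) :=
  {M of PseudoPointedMetric R M & PseudoMetric_isMetric R M}.

Section metric.
Context {R : realType}.

(* The library's [closed_ball] is the closure of the open ball, which can be
   strictly smaller. *)
Definition cball {X : metricType R} (x : X) (s : R) : set X :=
  [set y | mdist x y <= s].

Definition metric_bounded {X : metricType R} (A : set X) : Prop :=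
  exists M : R, forall x y, A x -> A y -> mdist x y <= M.

(* Meant for linear maps between normed spaces, where a set is norm-bounded
   exactly when it is bounded for the norm metric. *)
Definition compact_operator {E F : metricType R} (T : E -> F) : Prop :=
  forall A : set E, metric_bounded A -> precompact (T @` A).

End metric.

Definition borel {T : topologicalType} : set (set T) := <<s @open T >>.

(* The distance ||f - g||_1 on the space of classes modulo a.e. equality. *)
Section L1_metric.
Context d (T : measurableType d) (R : realType).
Variable mu : {measure set T -> \bar R}.
Implicit Types f g h : LspaceType1 mu.

Definition L1_dist f g : R := fine (Lnorm mu 1 (fun x => (f x - g x)%:E)).

Let L1_mfun f : measurable_fun setT (f : T -> R).
Proof. exact: (measurable_funPT (repr (f : {mfun_ mu, T >-> measurableTypeR R}))). Qed.

Let L1_int f : mu.-integrable setT (EFin \o (f : T -> R)).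
Proof.
apply/integrableP; split; first exact/measurable_EFinP.
have := @Lebesgue_finite _ _ _ _ _ _ f.
by rewrite /finite_norm Lnorm1.
Qed.

Let L1_intB f g : mu.-integrable setT (fun x => (f x - g x)%:E).
Proof.
rewrite (_ : (fun _ => _) = (EFin \o (f : T -> R)) \- (EFin \o (g : T -> R)))%E; last exact/funext.
exact: integrableB.
Qed.

Let L1_distE f g : (L1_dist f g)%:E = (\int[mu]_x `|(f x - g x)%:E|)%E.
Proof.
rewrite /L1_dist Lnorm1 fineK// ge0_fin_numE ?integral_ge0//.
by have /integrableP[] := L1_intB f g.
Qed.

Let L1_distxx f : L1_dist f f = 0.
Proof.
apply: EFin_inj; rewrite L1_distE.
by under eq_integral do rewrite subrr abse0; rewrite integral0.
Qed.

Let L1_dist_positivity f g : L1_dist f g = 0 -> f = g.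
Proof.
move=> fg0; have : (\int[mu]_x `|(f x - g x)%:E| = 0)%E by rewrite -L1_distE fg0.
have /integrableP[mfg _] := L1_intB f g.
move=> /(ae_eq_integral_abs mu measurableT mfg) fg.
have {}fg : ae_eq mu setT (f : T -> R) (g : T -> R).
  by apply: filterS fg => x /(_ I) [] /eqP; rewrite subr_eq0 => /eqP.
case: f fg {fg0 mfg} => f [[fP]]; case: g => g [[gP]] /= fg.
have efg : f = g.
  rewrite -[f]reprK -[g]reprK; apply/eqmodP/asboolP.
  exact: fg.
by move: fP gP; rewrite efg => fP gP; congr LebesgueSpace.Pack;
  rewrite (Prop_irrelevance fP gP).
Qed.

Let L1_dist_sym f g : L1_dist f g = L1_dist g f.
Proof.
apply: EFin_inj; rewrite !L1_distE; apply: eq_integral => x _.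
by rewrite !abse_EFin distrC.
Qed.

Let L1_mabs f g : measurable_fun setT (fun x => `|(f x - g x)%:E|%E).
Proof. by have /integrableP[mfg _] := L1_intB f g; exact: measurableT_comp. Qed.

Let L1_dist_triangle g f h : L1_dist f h <= L1_dist f g + L1_dist g h.
Proof.
rewrite -lee_fin EFinD !L1_distE -ge0_integralD//.
apply: ge0_le_integral => //; first exact: emeasurable_funD.
by move=> x _; rewrite -EFinD lee_fin -(subrKA (g x) (f x)) ler_normD.
Qed.

HB.instance Definition _ := gen_eqMixin (LspaceType1 mu).
HB.instance Definition _ := gen_choiceMixin (LspaceType1 mu).
HB.instance Definition _ := isMetric.Build R (LspaceType1 mu)
  L1_distxx L1_dist_positivity L1_dist_sym L1_dist_triangle.

End L1_metric.

Section metric_measure.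
Context {R : realType} {X : pmetricType R}.
Variable mu : {outer_measure set X -> \bar R}.

Definition cara_measure : {measure set (caratheodory_type mu) -> \bar R} :=
  (mu : set (caratheodory_type mu) -> \bar R).

Definition borel_measurable : Prop := borel `<=` mu.-caratheodory.

Definition borel_regular : Prop :=
  forall A : set X, exists B : set X, [/\ borel B, A `<=` B & mu B = mu A].

Definition doubling (s : R) : Prop :=
  exists2 gamma : R, 1 <= gamma &
    forall x, (mu (cball x (2 * s)) <= gamma%:E * mu (cball x s))%E.

Definition star (s : R) : Prop :=
  forall eps : R, 0 < eps -> exists2 delta : R, 0 < delta < s &
    forall x, (mu (cball x (s + delta) `\` cball x (s - delta)) < eps%:E)%E.

Definition averaging (r : R) (f : X -> R) (x : X) : R :=
  (fine (mu (cball x r)))^-1 * \int[cara_measure]_(y in cball x r) f y.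

Definition L1 : metricType R := LspaceType1 cara_measure.

End metric_measure.

(* Main.v *)
(* A_r is the integral operator with kernel K(x, y) = 1_{d(x,y) <= r} / mu(B(x,r)).
   Doubling makes bounded sets totally bounded, so K is jointly measurable and
   Schur's test bounds A_r on L^1.
   If X is bounded, mu(B(x,r)) is bounded below and, by (star)_r, y |-> K(., y)
   is uniformly continuous into L^1. Cutting X into finitely many small cells
   then approximates A_r in operator norm by finite rank operators.
   If X is unbounded, choose x_n pairwise more than 4r apart: the normalized
   indicators of the B(x_n, r/2) form a bounded sequence, but A_r maps the n-th
   one to 1 / mu(B(x,r)) on B(x_n, r/2) and the others to 0 there, so by doubling
   the images stay a fixed distance apart. *)
From HB Require Import structures.
Require Import Defs.
From mathcomp Require Import all_boot all_order all_algebra.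
From mathcomp Require Import all_classical all_reals all_analysis.
From mathcomp Require Import measurable_realfun ring lra.

Set Implicit Arguments.
Unset Strict Implicit.
Unset Printing Implicit Defensive.
Import Order.TTheory GRing.Theory Num.Theory numFieldNormedType.Exports.

Local Open Scope classical_set_scope.
Local Open Scope ring_scope.

(** * Precompact sets and sequences in metric spaces *)

Section compactness.
Context {R : realType} {E : metricType R}.

Lemma pow2V_lt (e : R) : 0 < e -> exists n, 2^-1 ^+ n < e.
Proof.
move=> e0.
have /cvgr0Pnorm_lt/(_ _ e0) [n _ /(_ n (leqnn _))] :
    (fun n => (2^-1 : R) ^+ n) @ \oo --> 0.
  by apply: cvg_expr; rewrite ger0_norm ?invr_ge0// invf_lt1 ?ltr1n.
by rewrite ger0_norm ?exprn_ge0 ?invr_ge0//; exists n.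
Qed.

(* The hypothesis [colour] is total boundedness: every colour class has diameter
   at most [e]. *)
Lemma colouring_precompact (A : set E)
    (cauchy_cvg : forall u : nat -> E,
      (forall n, mdist (u n) (u n.+1) <= 2^-1 ^+ n) ->
      exists l, forall e : R, 0 < e -> exists N, forall n, (N <= n)%N ->
        mdist (u n) l <= e)
    (colour : forall e : R, 0 < e -> exists (I : finType) (k : E -> I),
      forall x y, A x -> A y -> k x = k y -> mdist x y <= e) :
  precompact A.
Proof.
rewrite precompactE compact_ultra => F UF FA.
have small (e : R) : 0 < e -> exists2 V, F V &
    forall x y, V x -> V y -> mdist x y <= e.
  move=> e0; have e30 : 0 < e / 3 by lra.
  have [I [k kP]] := colour _ e30.
  (* Colours are controlled on [A] only, so a point of the closure gets the colour of a nearby point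
     [p x] of [A]; the two moves and the colour class cost [e / 3] each. *)
  have /choice[p pP] : forall x, exists y, closure A x -> A y /\ mdist x y < e / 3.
    move=> x; have [cx|cx] := pselect (closure A x); last by exists x.
    have [y [Ay xy]] := cx _ (nbhsx_ballx x _ e30).
    by exists y => _; split => //; move: xy; rewrite ballEmdist.
  (* Otherwise the ultrafilter contains the complements of these finitely many sets, whose
     intersection misses [closure A]. *)
  have [i Fi] : exists i, F [set x | closure A x /\ k (p x) = i].
    apply/not_existsP => FN.
    have : F (\big[setI/setT]_(i : I) ~` [set x | closure A x /\ k (p x) = i]).
      elim/big_ind : _ => [|? ? ? ?|i _]; [exact: filterT|exact: filterI|].
      by have [/FN//|] := in_ultra_setVsetC [set x | closure A x /\ k (p x) = i] UF.
    move=> /(filterI FA) /filter_ex [x [cx]].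
    by rewrite (bigD1 (k (p x)))//= => -[+ _]; apply.
  exists [set x | closure A x /\ k (p x) = i] => // x y [cx kx] [cy ky].
  have [Ax dx] := pP _ cx; have [Ay dy] := pP _ cy.
  have := kP _ _ Ax Ay (etrans kx (esym ky)).
  have := metric_triangle x (p x) y.
  have := metric_triangle (p x) (p y) y.
  by rewrite (metric_sym (p y)); lra.
have /choice[V VP] : forall n, exists V, F V /\
    forall x y, V x -> V y -> mdist x y <= 2^-1 ^+ n.
  by move=> n; have [|V FV VP] := small (2^-1 ^+ n);
    [rewrite exprn_gt0 ?invr_gt0 | exists V].
(* Taking [u n] in two successive sets puts [u n] and [u n.+1] together in [V n.+1], which gives the
   fast Cauchy condition. *)
have /choice[u uV] : forall n, exists x, V n x /\ V n.+1 x.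
  by move=> n; exact: (filter_ex (filterI (VP n).1 (VP n.+1).1)).
have [l ul] : exists l, forall e : R, 0 < e -> exists N, forall n, (N <= n)%N ->
    mdist (u n) l <= e.
  apply: cauchy_cvg => n; apply: le_trans ((VP n.+1).2 _ _ (uV n).2 (uV n.+1).1) _.
  by rewrite exprS ler_piMl ?exprn_ge0 ?invr_ge0// invf_le1 ?ler1n.
have Fl : F --> l.
  apply/metricType_numDomainType.fcvgrPdist_lt => e e0.
  have e30 : 0 < e / 3 by lra.
  have [N uN] := ul _ e30; have [n0 n0e] := pow2V_lt e30.
  pose n := maxn N n0.
  have ne : 2^-1 ^+ n < e / 3.
    apply: le_lt_trans n0e; apply: ler_wiXn2l; last exact: leq_maxr.
      by rewrite invr_ge0.
    by rewrite invf_le1 ?ler1n.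
  apply: filterS (VP n).1 => x Vx.
  have := (VP n).2 _ _ (uV n).1 Vx; have := uN n (leq_maxl _ _).
  have := metric_triangle l (u n) x.
  by rewrite (metric_sym l (u n)); lra.
exists l; split => //.
have /closure_id -> := @closed_closure _ A.
move=> B /Fl FB; exact: (filter_ex (filterI FA FB)).
Qed.

End compactness.

(** The sequence has a cluster point [p], and arbitrarily late terms lie within [e / 2] of it. *)
Lemma precompact_close_terms (R : realType) (E : metricType R) (S : set E)
    (u : nat -> E) (e : R) : precompact S -> (forall n, S (u n)) -> 0 < e ->
  exists i j, (i < j)%N /\ mdist (u i) (u j) < e.
Proof.
rewrite precompactE => cS Su e0; have e20 : 0 < e / 2 by lra.
have clS : (u @ \oo) (closure S).
  by exists 0%N => // n _; exact: subset_closure.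
have [p [_ clp]] := cS (u @ \oo) _ clS.
have near_p N : exists2 n, (N <= n)%N & mdist p (u n) < e / 2.
  have uN : (u @ \oo) [set u n | n in [set n | (N <= n)%N]].
    by exists N => // n /= Nn; exists n.
  have [_ [[n /= Nn <-]]] := clp _ _ uN (nbhsx_ballx p _ e20).
  by rewrite ballEmdist; exists n.
have [i _ pi] := near_p 0%N; have [j ij pj] := near_p i.+1.
exists i, j; split => //.
by have := metric_triangle (u i) p (u j); rewrite (metric_sym (u i) p); lra.
Qed.

Lemma unbounded_separated (R : realType) (X : metricType R) (x0 : X) (D : R) :
  ~ metric_bounded [set: X] ->
  exists u : nat -> X, forall i j, (i < j)%N -> D < mdist (u i) (u j).
Proof.
move=> unb.
have /choice[g gP] : forall rho : R, exists x, rho < mdist x0 x.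
  move=> rho; apply/not_existsP => H; apply: unb; exists (rho + rho) => x y _ _.
  have := H x; have := H y => /negP; rewrite -leNgt => ? /negP; rewrite -leNgt => ?.
  by have := metric_triangle x x0 y; rewrite (metric_sym x x0); lra.
(* The distance to [x0] grows by more than [D] at each step; the maximum with 0 keeps it increasing
   even for negative [D], so the gap persists for all later terms. *)
pose u := fix u n := if n is k.+1 then g (mdist x0 (u k) + Num.max D 0) else x0.
exists u => i j ij.
suff : mdist x0 (u i) + Num.max D 0 < mdist x0 (u j).
  have DM : D <= Num.max D 0 by rewrite le_max lexx.
  by have := metric_triangle x0 (u i) (u j); lra.
elim: j ij => // j IH; rewrite ltnS leq_eqVlt => /predU1P[->|/IH]; first exact: gP.
have M0 : 0 <= Num.max D 0 by rewrite le_max lexx orbT.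
by have /= := gP (mdist x0 (u j) + Num.max D 0); lra.
Qed.

Lemma summable_increments_cvg (R : realType) (v : nat -> R) (M : R) :
  (forall m, \sum_(0 <= k < m) `|v k.+1 - v k| <= M) ->
  cvgn v.
Proof.
move=> vM.
have c : cvgn (series (fun k => v k.+1 - v k)).
  apply: normed_cvg; apply: nondecreasing_is_cvgn.
    by apply: nondecreasing_series => n _ _; exact: normr_ge0.
  by exists M => _ [m _ <-] /=; rewrite seriesEnat; exact: vM.
have -> : v = (fun n => v 0%N + series (fun k => v k.+1 - v k) n).
  by apply/funext => n; rewrite seriesEnat/= telescope_sumr// addrC subrK.
by apply: is_cvgD => //; exact: is_cvg_cst.
Qed.

(** * Integrable functions, their classes, and completeness of L^1 *)

Section L1_classes.
Context d (T : measurableType d) (R : realType).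
Variable mu : {measure set T -> \bar R}.
Implicit Types f g : LspaceType1 mu.

Lemma L1_measurable f : measurable_fun setT (f : T -> R).
Proof.
exact: (measurable_funPT (repr (f : {mfun_ mu, T >-> measurableTypeR R}))).
Qed.

Lemma L1_integrable f : mu.-integrable setT (EFin \o (f : T -> R)).
Proof.
apply/integrableP; split; first exact/measurable_EFinP/L1_measurable.
by have := @Lebesgue_finite _ _ _ _ _ _ f; rewrite /finite_norm Lnorm1.
Qed.

Lemma L1_mdistE f g :
  ((mdist f g : R)%:E = \int[mu]_x `|(f x - g x)%:E|)%E.
Proof.
rewrite [LHS](_ : _ = (fine (Lnorm mu 1 (fun x => (f x - g x)%:E)))%:E)//.
rewrite Lnorm1 fineK// ge0_fin_numE ?integral_ge0//.
by have /integrableP[] := integrableB measurableT (L1_integrable f) (L1_integrable g).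
Qed.

(** The representative chosen by the quotient agrees with [f] only almost everywhere, which is
    enough to transfer the finiteness of the norm. *)
Lemma L1_class (f : T -> R) : mu.-integrable setT (EFin \o f) ->
  exists F : LspaceType1 mu, ae_eq mu setT F f.
Proof.
move=> /integrableP[/measurable_EFinP mf intf].
pose f' : {mfun T >-> measurableTypeR R} := 
  HB.pack f (@isMeasurableFun.Build _ _ T (measurableTypeR R) f mf).
pose c : {mfun_ mu, T >-> measurableTypeR R} :=
  \pi_(aeEqMfun (measurableTypeR R) mu)%qT f'.
have cf : ae_eq mu setT (c : T -> R) f.
  have /eqmodP/asboolP : repr c = f' %[mod aeEqMfun (measurableTypeR R) mu]%qT
    by rewrite reprK.
  by [].
have fc : finite_norm mu 1 (c : T -> R).
  rewrite /finite_norm Lnorm1.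
  rewrite (ae_eq_integral (fun x => `|(f x)%:E|)%E)//.
  - apply: measurableT_comp => //; apply/measurable_EFinP.
    exact: (measurable_funPT (repr c)).
  - exact/measurableT_comp/measurable_EFinP.
  - by apply: filterS cf => x /= /[apply] ->.
pose F : LspaceType1 mu :=
  HB.pack c (isFinLebesgue.Build _ _ _ _ _ (@lexx _ _ 1%E) c fc).
by exists F.
Qed.

(** Riesz-Fischer argument: the tail [G n] of the series of increments has integral at most
    [2 / 2 ^+ n], so the sequence converges almost everywhere, and [G n] dominates the distance from
    [u n] to the limit. *)
Theorem L1_fast_cauchy_cvg (u : nat -> LspaceType1 mu) :
  (forall n, mdist (u n) (u n.+1) <= 2^-1 ^+ n) ->
  exists l, forall e : R, 0 < e -> exists N, forall n, (N <= n)%N ->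
    mdist (u n) l <= e.
Proof.
move=> du.
pose a k x := `|(u k x - u k.+1 x)%:E|%E.
have a0 k x : (0 <= a k x)%E by exact: abse_ge0.
have ma k : measurable_fun setT (a k).
  apply: measurableT_comp => //; apply/measurable_EFinP.
  by apply: measurable_funB; exact: L1_measurable.
pose G n x := (\sum_(k <oo) a (k + n)%N x)%E.
have G0 n x : (0 <= G n x)%E by apply: nneseries_ge0 => k _ _; exact: abse_ge0.
have mG n : measurable_fun setT (G n).
  apply: (ge0_emeasurable_sum (P := xpredT)) => k *; [exact: abse_ge0|exact: ma].
have intG n : (\int[mu]_x G n x <= (2 / 2 ^+ n)%:E)%E.
  rewrite integral_nneseries//.
  have /cvg_lim <- // := @cvg_geometric_eseries_half R 2 n.
  apply: lee_nneseries => [k _ _|k _]; first by apply: integral_ge0.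
  rewrite -L1_mdistE lee_fin (le_trans (du _))//.
  by rewrite addnS expnS natrM invfM mulrA divff// mul1r natrX exprVn.
have sumG n m x : ((\sum_(0 <= k < m) `|u (k + n).+1 x - u (k + n)%N x|)%:E <= G n x)%E.
  rewrite -sumEFin (eq_bigr (fun k => a (k + n)%N x)); last first.
    by move=> k _; rewrite /a abse_EFin distrC.
  exact: nneseries_lim_ge.
(* The upper limit is measurable on the whole space and equals the limit wherever the sequence
   converges. *)
pose h x := fine (limn_esup (fun n => (u n x)%:E)).
have mh : measurable_fun setT h.
  apply: measurableT_comp => //.
  by apply: measurable_fun_limn_esup => n; exact/measurable_EFinP/L1_measurable.
have iG : mu.-integrable setT (G 0%N).
  apply/integrableP; split => //.
  under eq_integral do rewrite gee0_abs//.
  exact: le_lt_trans (intG 0%N) (ltry _).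
have hG : {ae mu, forall x, forall n, (`|(u n x - h x)%:E| <= G n x)%E}.
  apply: filterS (integrable_ae measurableT iG) => x /(_ I) Gfin n.
  have cu : cvgn (fun n => u n x).
    apply: (@summable_increments_cvg _ _ (fine (G 0%N x))) => m.
    have := sumG 0%N m x; rewrite -{1}(fineK Gfin) lee_fin.
    by under eq_bigr do rewrite addn0.
  have uh : (fun n => u n x) @ \oo --> h x.
    have uE : (fun n => (u n x)%:E) @ \oo --> (limn (fun n => u n x))%:E.
      by apply: cvg_EFin; [exact: nearW|exact: cu].
    by rewrite /h is_cvg_limn_esupE ?(cvg_lim _ uE)//; exact: cvgP uE.
  (* Finiteness is at hand for [G 0] only; an infinite [G n x] makes the bound trivial. *)
  have [->|Gy] := eqVneq (G n x) +oo%E; first exact: leey.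
  have Gnf : G n x \is a fin_num by rewrite ge0_fin_numE// ltey.
  rewrite -(fineK Gnf) lee_fin.
  have cd : (fun m => `|u n x - u (m + n)%N x|) @ \oo --> `|u n x - h x|.
    apply: cvg_norm; apply: cvgB; first exact: cvg_cst.
    by rewrite (cvg_shiftn n (fun n => u n x)).
  rewrite -(cvg_lim (@Rhausdorff R) cd).
  apply: limr_le; first by apply/cvg_ex; eexists; exact: cd.
  apply: nearW => m; rewrite -lee_fin fineK// (le_trans _ (sumG n m x))// lee_fin.
  rewrite distrC -[X in _ - u X x]add0n -(telescope_sumr (fun k => u (k + n)%N x))//.
  exact: ler_norm_sum.
have ih : mu.-integrable setT (EFin \o h).
  apply/integrableP; split; first exact/measurable_EFinP.
  (* The bound of [hG] at index 0 dominates [h] by an integrable function. *)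
  apply: (@le_lt_trans _ _ (\int[mu]_x (`|(u 0%N x)%:E| + G 0%N x))%E).
    apply: ae_ge0_le_integral => //.
    - exact/measurableT_comp/measurable_EFinP.
    - by move=> x _; rewrite adde_ge0.
    - apply: emeasurable_funD => //.
      exact/measurableT_comp/measurable_EFinP/L1_measurable.
    - apply: filterS hG => x /(_ 0%N) + _ => /=.
      have [->|Gy] := eqVneq (G 0%N x) +oo%E; first by rewrite addey ?leey.
      have Gnf : G 0%N x \is a fin_num by rewrite ge0_fin_numE// ltey.
      rewrite -(fineK Gnf) !lee_fin => H.
      by have := ler_distD (u 0%N x) (h x) 0; rewrite !subr0 distrC; lra.
  rewrite ge0_integralD//; last first.
    exact/measurableT_comp/measurable_EFinP/L1_measurable.
  apply: lte_add_pinfty; last exact: le_lt_trans (intG 0%N) (ltry _).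
  by have /integrableP[] := L1_integrable (u 0%N).
have [l lh] := L1_class ih.
exists l => e e0; have e20 : 0 < e / 2 by lra.
have [N Ne] := pow2V_lt e20; exists N => n Nn.
rewrite -lee_fin L1_mdistE.
apply: (@le_trans _ _ (\int[mu]_x G n x)%E).
  apply: ae_ge0_le_integral => //.
  - apply: measurableT_comp => //; apply/measurable_EFinP.
    by apply: measurable_funB; exact: L1_measurable.
  - by apply: filterS2 hG lh => x hx /(_ I) lx _; rewrite lx; exact: hx.
rewrite (le_trans (intG n))// lee_fin -exprVn.
have : (2^-1 : R) ^+ n <= 2^-1 ^+ N.
  by apply: ler_wiXn2l => //; rewrite invf_le1// ler1n.
by lra.
Qed.

End L1_classes.

(** * Integral operators: measurability, Schur's test and finite rank approximation *)

Lemma le_abse_fine (R : realType) (x : \bar R) : (`|(fine x)%:E| <= `|x|)%E.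
Proof. by case: x => //=; rewrite normr0 leey. Qed.

Section integral_operators.
Context d (T : measurableType d) (R : realType).
Variable m : {measure set T -> \bar R}.
Hypothesis sfm : sigma_finite setT m.

(** A copy of [m] on which [sfm] is registered as a sigma-finite structure, the form in which the
    Fubini-Tonelli lemmas take it. *)
Let m' : set T -> \bar R := m.

HB.instance Definition _ := Measure.on m'.
HB.instance Definition _ := Measure_isSigmaFinite.Build _ _ _ m' sfm.

(** Tonelli applies to the positive and negative parts of [g] separately; the real integral is
    [fine] of the difference. *)
Lemma measurable_fun_Rintegral (g : T * T -> R) : measurable_fun setT g ->
  measurable_fun setT (fun x => \int[m]_y g (x, y)).
Proof.
move=> mg; apply: measurableT_comp => //.
have mge : measurable_fun setT (EFin \o g) by exact/measurable_EFinP.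
rewrite (_ : (fun _ => _) = (fubini_F m' (EFin \o g)^\+) \-
    (fubini_F m' (EFin \o g)^\-))%E; last first.
  by apply/funext => x; rewrite [LHS]integralE; congr (_ - _)%E;
    apply: eq_integral => y _; rewrite ?funeposE ?funenegE.
apply: emeasurable_funB.
- apply: measurable_fun_fubini_tonelli_F => [|z].
    exact: measurable_funepos.
  exact: funepos_ge0.
- apply: measurable_fun_fubini_tonelli_F => [|z].
    exact: measurable_funeneg.
  exact: funeneg_ge0.
Qed.

(** The L^1 case of Schur's test: move the absolute value inside, exchange the integrals by Tonelli,
    and bound the inner integral of the kernel for each fixed [y]. *)
Lemma schur_bound (K : T * T -> R) (C : R) (f : T -> R) :
  measurable_fun setT K -> measurable_fun setT f ->
  (forall y, (\int[m]_x `|(K (x, y))%:E| <= C%:E)%E) ->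
  (\int[m]_x `|(\int[m]_y (K (x, y) * f y)%R)%:E|
    <= C%:E * \int[m]_y `|(f y)%:E|)%E.
Proof.
move=> mK mf KC.
pose g z := (K z * f z.2)%R.
have mg : measurable_fun setT g.
  by apply: measurable_funM => //; exact: measurableT_comp.
pose G z := `|(g z)%:E|%E.
have mG : measurable_fun setT G by exact/measurableT_comp/measurable_EFinP.
have G0 z : (0 <= G z)%E by exact: abse_ge0.
apply: (@le_trans _ _ (\int[m']_x fubini_F m' G x)%E).
  apply: ge0_le_integral => //.
  - apply: measurableT_comp => //; apply/measurable_EFinP.
    exact: (measurable_fun_Rintegral mg).
  - exact: measurable_fun_fubini_tonelli_F.
  (* Where the inner integral is not finite, [fine] returns 0 and the inequality survives. *)
  - move=> x _; apply: le_trans (le_abse_fine _) _.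
    apply: (le_abse_integral m' measurableT (f := fun y => (g (x, y))%:E)).
    exact/measurable_EFinP/measurableT_comp.
rewrite -fubini_tonelli1// fubini_tonelli2//.
have C0 : (0 <= C%:E)%E by rewrite (le_trans _ (KC point))// integral_ge0.
have mf' : measurable_fun setT (fun y => `|(f y)%:E|%E).
  exact/measurableT_comp/measurable_EFinP.
rewrite -ge0_integralZl//.
apply: ge0_le_integral => //.
- by move=> y _; apply: integral_ge0.
- exact: measurable_fun_fubini_tonelli_G.
- exact: measurable_funeM.
move=> y _; rewrite /fubini_G.
rewrite (eq_integral (fun x => `|(f y)%:E| * `|(K (x, y))%:E|)%E); last first.
  by move=> x _; rewrite /G /g EFinM abseM muleC.
rewrite ge0_integralZl//; last first.
  apply: measurableT_comp => //; apply/measurable_EFinP.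
  exact: measurableT_comp.
by rewrite muleC lee_wpmul2r.
Qed.

End integral_operators.

Section finite_rank.
Context d (T : measurableType d) (R : realType).
Variable m : {measure set T -> \bar R}.

Lemma integrable_bounded_mul (g h : T -> R) (b : R) :
  measurable_fun setT g -> (forall y, `|g y| <= b) ->
  m.-integrable setT (EFin \o h) ->
  m.-integrable setT (fun y => (g y * h y)%:E).
Proof.
move=> mg gb ih.
have /integrableP[/measurable_EFinP mh _] := ih.
apply: le_integrable (integrableZl measurableT b ih) => //.
  by apply/measurable_EFinP; exact: measurable_funM.
move=> y _ /=; rewrite lee_fin !normrM ler_wpM2r//.
by rewrite (le_trans (gb y))// ler_norm.
Qed.

Lemma Rintegral_sum (I : Type) (s : seq I) (h : I -> T -> R) :
  (forall i, m.-integrable setT (EFin \o h i)) ->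
  \int[m]_x (\sum_(i <- s) h i x) = \sum_(i <- s) \int[m]_x h i x.
Proof.
move=> ih; rewrite /Rintegral.
under eq_integral do rewrite -sumEFin.
rewrite integral_sum// -sum_fine// => i _.
exact: (integrable_fin_num measurableT (ih i)).
Qed.

Hypothesis sfm : sigma_finite setT m.

(** Split [K] into the finite rank kernel and a remainder [L]. Schur's test gives [L] norm at most
    [eps]; the finite rank part sees [h] only through its integrals over the cells [E i]. *)
Lemma finite_rank_approx (N : nat) (K : T * T -> R) (k : 'I_N -> T -> R)
    (E : 'I_N -> set T) (eps C : R) (h : T -> R) :
  measurable_fun setT K -> (forall x, exists b, forall y, `|K (x, y)| <= b) ->
  (forall i, measurable_fun setT (k i)) -> (forall i, measurable (E i)) ->
  (forall y, (\int[m]_x `|(K (x, y) - \sum_i k i x * \1_(E i) y)%:E|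
    <= eps%:E)%E) ->
  (forall i, (\int[m]_x `|(k i x)%:E| <= C%:E)%E) ->
  m.-integrable setT (EFin \o h) ->
  (\int[m]_x `|(\int[m]_y (K (x, y) * h y)%R)%:E| <=
   eps%:E * \int[m]_y `|(h y)%:E|
   + (C * \sum_i `|\int[m]_y (\1_(E i) y * h y)|)%:E)%E.
Proof.
move=> mK bK mk mE Keps kC ih.
have /integrableP[/measurable_EFinP mh _] := ih.
pose L z := K z - \sum_i k i z.1 * \1_(E i) z.2.
have mL : measurable_fun setT L.
  apply: measurable_funB => //; apply: measurable_sum => i.
  apply: measurable_funM; first exact: measurableT_comp.
  exact: (measurableT_comp (measurable_indic (mE i))).
have iE i : m.-integrable setT (fun y => (\1_(E i) y * h y)%:E).
  apply: (@integrable_bounded_mul _ _ 1) => // y.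
  by rewrite indicE; case: (_ \in _); rewrite ?normr1 ?normr0.
have iK x : m.-integrable setT (fun y => (K (x, y) * h y)%:E).
  have [b Kb] := bK x.
  by apply: (@integrable_bounded_mul _ _ b) => //; exact: measurableT_comp.
pose c i := \int[m]_y (\1_(E i) y * h y).
have KE x : \int[m]_y (K (x, y) * h y) =
    \int[m]_y (L (x, y) * h y) + \sum_i k i x * c i.
  have ikE i : m.-integrable setT (EFin \o (fun y => k i x * (\1_(E i) y * h y))).
    exact: (integrableZl measurableT (k i x) (iE i)).
  rewrite (_ : \sum_i _ = \int[m]_y \sum_i k i x * (\1_(E i) y * h y)).
    rewrite -RintegralD//.
    - apply: eq_Rintegral => y _; rewrite /L/= mulrBl mulr_suml.
      by under [X in _ = _ - X + _]eq_bigr do rewrite -mulrA; rewrite subrK.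
    - rewrite (_ : _ \o _ = (fun y => (K (x, y) * h y)%:E) \-
          (fun y => \sum_i (k i x * (\1_(E i) y * h y))%:E))%E; last first.
        apply/funext => y; rewrite /L/= sumEFin -EFinB mulrBl mulr_suml.
        by under eq_bigr do rewrite -mulrA.
      by apply: integrableB => //; apply: integrable_sum => [//|i _]; exact: ikE.
    - rewrite (_ : _ \o _ = (fun y => \sum_i (k i x * (\1_(E i) y * h y))%:E))%E.
        by apply: integrable_sum => [//|i _]; exact: ikE.
      by apply/funext => y; rewrite /= sumEFin.
  rewrite Rintegral_sum//; apply: eq_bigr => i _.
  by rewrite RintegralZl//; exact: iE.
have mLe : measurable_fun setT (fun x => \int[m]_y (L (x, y) * h y)).
  apply: (measurable_fun_Rintegral sfm (g := fun z => L z * h z.2)).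
  by apply: measurable_funM => //; exact: measurableT_comp.
apply: (@le_trans _ _ (\int[m]_x (`|(\int[m]_y (L (x, y) * h y)%R)%:E| +
    \sum_i `|(c i)%:E| * `|(k i x)%:E|))%E).
  apply: ge0_le_integral => //.
  - apply: measurableT_comp => //; apply/measurable_EFinP.
    apply: (measurable_fun_Rintegral sfm (g := fun z => K z * h z.2)).
    by apply: measurable_funM => //; exact: measurableT_comp.
  - apply: emeasurable_funD.
      exact/measurableT_comp/measurable_EFinP.
    apply: emeasurable_sum => i; apply: measurable_funeM.
    exact/measurableT_comp/measurable_EFinP.
  - move=> x _; rewrite KE.
    rewrite [leRHS](_ : _ = (`|\int[m]_y (L (x, y) * h y)| +
        \sum_i `|k i x * c i|)%:E); last first.
      rewrite EFinD -sumEFin; congr (_ + _)%E; apply: eq_bigr => i _.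
      by rewrite normrM EFinM muleC.
    rewrite lee_fin (le_trans (ler_normD _ _))// lerD2l.
    exact: ler_norm_sum.
rewrite ge0_integralD//; last 3 first.
- exact/measurableT_comp/measurable_EFinP.
- by move=> x _; apply: sume_ge0 => i _; rewrite mule_ge0.
- apply: emeasurable_sum => i; apply: measurable_funeM.
  exact/measurableT_comp/measurable_EFinP.
apply: leeD; first exact: schur_bound.
rewrite ge0_integral_sum//; last first.
  by move=> i; apply: measurable_funeM; exact/measurableT_comp/measurable_EFinP.
rewrite mulr_sumr -sumEFin; apply: lee_sum => i _.
rewrite ge0_integralZl//; last exact/measurableT_comp/measurable_EFinP.
by rewrite mulrC EFinM lee_wpmul2l.
Qed.

End finite_rank.

(** * Balls in a doubling space: measure bounds, finite nets, measurability of the distance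
    relation *)

Section balls.
Context {R : realType} {X : pmetricType R}.
Variable mu : {outer_measure set X -> \bar R}.
Hypothesis mu_borel : borel_measurable mu.
Hypothesis mu_ball : forall (x : X) (s : R), 0 < s ->
  (0%E < mu (cball x s) < +oo)%E.

Local Notation T := (caratheodory_type mu).
Local Notation m := (cara_measure mu).

Lemma sub_cball (x y : X) (s t : R) : mdist x y + s <= t ->
  cball y s `<=` cball x t.
Proof.
by move=> st z; rewrite /cball/=; have := metric_triangle x y z; lra.
Qed.

Lemma measurable_cball (x : X) (s : R) : measurable (cball x s : set T).
Proof.
rewrite -[X in measurable X]setCK; apply: measurableC.
apply: mu_borel; apply: sub_gen_smallest.
rewrite openE => y; rewrite /cball/= => /negP; rewrite -ltNge => sxy.
have e0 : 0 < mdist x y - s by rewrite subr_gt0.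
apply: filterS (nbhsx_ballx y _ e0) => z; rewrite ballEmdist/= => yz.
apply/negP; rewrite -ltNge.
by have := metric_triangle x z y; rewrite (metric_sym z y); lra.
Qed.

Lemma cball_fin_num (x : X) (s : R) : mu (cball x s) \is a fin_num.
Proof.
rewrite ge0_fin_numE; last exact: outer_measure_ge0.
(* The maximum with 1 covers [s <= 0], where [mu_ball] gives nothing. *)
have s0 : 0 < Num.max s 1 by rewrite lt_max ltr01 orbT.
have /andP[_] := mu_ball x s0; apply: le_lt_trans.
apply: le_outer_measure; apply: sub_cball.
by rewrite mdistxx add0r le_max lexx.
Qed.

Lemma fine_cball_gt0 (x : X) (s : R) : 0 < s -> 0 < fine (mu (cball x s)).
Proof. by move=> s0; apply: fine_gt0; exact: mu_ball. Qed.

Lemma sigma_finite_cara : sigma_finite setT m.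
Proof.
exists (fun n => cball (point : X) n.+1%:R).
  apply/esym/seteqP; split => // x _.
  have [n xn] : exists n, mdist (point : X) x <= n%:R.
    by exists (Num.bound (mdist (point : X) x));
      rewrite ltW// archi_boundP// mdist_ge0.
  by exists n => //=; rewrite /cball/= (le_trans xn)// ler_nat.
move=> n; split; first exact: measurable_cball.
by have /andP[_] := mu_ball (point : X) (ltr0Sn R n).
Qed.

Hypothesis mu_doubling : forall s : R, 0 < s -> doubling mu s.

Lemma doubling_iter (k : nat) (s : R) : 0 < s -> exists2 g : R, 0 < g &
  forall x, (mu (cball x (2 ^+ k * s)) <= g%:E * mu (cball x s))%E.
Proof.
move=> s0; elim: k => [|k [g g0 gP]].
  by exists 1 => // x; rewrite expr0 mul1r mul1e.
have [h h1 hP] := mu_doubling (mulr_gt0 (exprn_gt0 k (ltr0Sn R 1)) s0).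
have h0 : 0 < h by lra.
exists (h * g) => [|x]; first exact: mulr_gt0.
rewrite exprS -mulrA (le_trans (hP x))// EFinM -muleA.
by rewrite lee_pmul2l// lte_fin.
Qed.

(** For [k] large the ball of radius [2 ^+ k * s] about [x] contains a fixed ball about [x0], and
    [k] doublings bring its measure back to that of [cball x s]. *)
Lemma cball_measure_lbound (x0 : X) (M s : R) : 0 < s -> exists2 c : R, 0 < c &
  forall x, mdist x0 x <= M -> (c%:E <= mu (cball x s))%E.
Proof.
move=> s0.
have [k kP] : exists k, 2 * (Num.max M 1) <= 2 ^+ k * s.
  have sM : 0 < s / (2 * Num.max M 1).
    by rewrite divr_gt0// mulr_gt0// lt_max ltr01 orbT.
  have [k kP] := pow2V_lt sM; exists k.
  move: kP; rewrite exprVn ltr_pdivlMr ?mulr_gt0// ?lt_max ?ltr01 ?orbT//.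
  by rewrite mulrC ltr_pdivrMr ?exprn_gt0// => /ltW; rewrite [s * _]mulrC.
have [g g0 gP] := doubling_iter k s0.
have M0 : 0 < Num.max M 1 by rewrite lt_max ltr01 orbT.
exists (fine (mu (cball x0 (Num.max M 1))) / g) => [|x xM].
  by rewrite divr_gt0// fine_cball_gt0.
rewrite EFinM lee_pdivrMr// fineK ?cball_fin_num// muleC.
apply: le_trans (gP x); apply: le_outer_measure; apply: sub_cball.
apply: le_trans kP; rewrite metric_sym mulr2n mulrDl mul1r lerD2r.
by rewrite le_max xM.
Qed.

(** Packing argument: without a finite net there are arbitrarily many points more than [delta]
    apart. Their balls of radius [delta / 3] are disjoint, have measure at least [c], and lie in one
    ball of finite measure. *)
Lemma cball_finite_net (x0 : X) (M delta : R) : 0 < M -> 0 < delta ->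
  exists s : seq X, forall x, mdist x0 x <= M ->
    exists2 q, q \in s & mdist q x <= delta.
Proof.
move=> M0 delta0; apply: contrapT => noNet.
have d30 : 0 < delta / 3 by lra.
have [c c0 cP] := cball_measure_lbound x0 M d30.
pose U (s : seq X) : set T := \big[setU/set0]_(q <- s) cball q (delta / 3).
have mU s : measurable (U s).
  by apply: bigsetU_measurable => q _; exact: measurable_cball.
have UE s : U s = \bigcup_(q in [set` s]) cball q (delta / 3).
  by rewrite bigcup_seq.
have packing n : exists2 s : seq X, (forall q, q \in s -> mdist x0 q <= M) &
    ((c *+ n)%:E <= m (U s))%E.
  elim: n => [|n [s sM sc]].
    by exists [::] => //; rewrite mulr0n.
  have [x [xM xs]] : exists x, mdist x0 x <= M /\
      forall q, q \in s -> delta < mdist q x.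
    apply: contrapT => xN; apply: noNet; exists s => x xM.
    apply: contrapT => qN; apply: xN; exists x; split => // q qs.
    by rewrite ltNge; apply/negP => qx; apply: qN; exists q.
  exists (x :: s) => [q|]; first by rewrite inE => /predU1P[->//|/sM].
  rewrite /U big_cons -/(U s) measureU//.
  - rewrite mulrS EFinD leeD//; exact: cP.
  - exact: measurable_cball.
  apply/seteqP; split => // y [xy]; rewrite UE => -[q /= qs qy].
  have := xs _ qs; have := metric_triangle q y x.
  by move: xy qy; rewrite /cball/= (metric_sym y x); lra.
(* So many disjoint balls have total measure above that of [cball x0 (M + delta)], which contains
   them. *)
have [s sM] := packing (Num.bound (fine (mu (cball x0 (M + delta))) / c)).
apply/negP; rewrite -ltNge.
apply: (@le_lt_trans _ _ (mu (cball x0 (M + delta)))).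
  apply: le_outer_measure; rewrite UE; apply: bigcup_sub => q /= qs.
  by apply: sub_cball; have := sM _ qs; lra.
rewrite -(fineK (cball_fin_num _ _)) lte_fin -mulr_natr mulrC -ltr_pdivrMr//.
by rewrite archi_boundP// divr_ge0 ?ltW// fine_cball_gt0//; lra.
Qed.

(* [mdist x y <= r] iff for every [n] some point [q] of a countable dense set
   satisfies [mdist q x <= 1 / n] and [mdist q y <= r + 1 / n]. *)
Lemma measurable_mdist_le (r : R) :
  measurable ([set z | mdist (z.1 : X) z.2 <= r] : set (T * T)).
Proof.
(* Finite nets exist in bounded regions only, so stage [n] constrains just the [x] within [n.+1] of
   [point]; every [x] is constrained from some stage on. *)
have /choice[N NP] : forall n : nat, exists s : seq X,
    forall x, mdist (point : X) x <= n.+1%:R ->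
    exists2 q, q \in s & mdist q x <= n.+1%:R^-1.
  by move=> n; apply: cball_finite_net => //; rewrite invr_gt0.
rewrite (_ : [set _ | _] = \bigcap_n
    ((~` cball (point : X) n.+1%:R) `*` setT `|`
     \big[setU/set0]_(q <- N n)
       (cball q n.+1%:R^-1 `*` cball q (r + n.+1%:R^-1)))); last first.
  apply/seteqP; split => [[x y] /= xy n _|[x y] H /=].
    have [xn|xn] := pselect (mdist (point : X) x <= n.+1%:R); last by left.
    right; have [q qN qx] := NP _ _ xn.
    rewrite -bigcup_seq; exists q => //; split => //=; rewrite /cball/=.
    by move: qx xy (metric_triangle q x y); move: (n.+1%:R^-1) => v; lra.
  apply/ler_addgt0Pr => e e0.
  have [n1 n1P] : exists n1 : nat, mdist (point : X) x <= n1%:R.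
    by exists (Num.bound (mdist (point : X) x));
      rewrite ltW// archi_boundP// mdist_ge0.
  have [n2 n2P] : exists n2 : nat, (e / 2)^-1 <= n2%:R.
    exists (Num.bound (e / 2)^-1); rewrite ltW// archi_boundP// invr_ge0; lra.
  pose n := maxn n1 n2.
  have xn : mdist (point : X) x <= n.+1%:R.
    by rewrite (le_trans n1P)// ler_nat ltnW// ltnS leq_maxl.
  have ne : n.+1%:R^-1 <= e / 2.
    rewrite -[leRHS]invrK lef_pV2 ?posrE ?invr_gt0//; last lra.
    by rewrite (le_trans n2P)// ler_nat ltnW// ltnS leq_maxr.
  have [[/=]|] := H n I; first by rewrite /cball/= xn.
  rewrite -bigcup_seq => -[q _ [/=]]; rewrite /cball/= => qx qy.
  move: ne qx qy (metric_triangle x q y); rewrite (metric_sym x q).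
  by move: (n.+1%:R^-1) => v; lra.
apply: bigcap_measurable => // n _; apply: measurableU.
  by apply: measurableX => //; apply: measurableC; exact: measurable_cball.
by apply: bigsetU_measurable => q _; apply: measurableX; exact: measurable_cball.
Qed.

(** By the triangle inequality the symmetric difference lies in the annulus about [y] that [star]
    makes small. *)
Lemma star_diff (r : R) : star mu r -> forall eps : R, 0 < eps ->
  exists2 delta : R, 0 < delta & forall y y', mdist y y' <= delta ->
    (mu (cball y r `\` cball y' r `|` (cball y' r `\` cball y r)) < eps%:E)%E.
Proof.
move=> st eps /st[delta /andP[delta0 _] deltaP]; exists delta => // y y' yy'.
apply: le_lt_trans (deltaP y); apply: le_outer_measure.
have := metric_sym y y' => s z; rewrite /cball/= => -[] [/= h1 /negP];
  rewrite -ltNge => h2; (split; [|apply/negP; rewrite -ltNge]) => /=.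
- by lra.
- by have := metric_triangle y' y z; lra.
- by have := metric_triangle y y' z; lra.
- by lra.
Qed.

End balls.

(** The colour of [s] is the index of its cell when the interval from [- M] to [M] is cut into
    pieces of length [eta]. *)
Lemma finite_colouring_itv (R : realType) (M eta : R) : 0 < eta ->
  exists (L : nat) (b : R -> 'I_L.+1), forall s t,
    `|s| <= M -> `|t| <= M -> b s = b t -> `|s - t| <= eta.
Proof.
move=> eta0; pose p s : nat := Num.truncn ((s + M) / eta).
(* The index at [s = M] is the largest one, so [inord] leaves the indices of points of the interval
   unchanged. *)
exists (Num.truncn (2 * M / eta)), (fun s => inord (p s)) => s t sM tM.
have M0 : 0 <= M by exact: le_trans sM.
have pP u : `|u| <= M -> (p u < (Num.truncn (2 * M / eta)).+1)%N /\
    (p u)%:R * eta <= u + M < (p u).+1%:R * eta.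
  rewrite ler_norml => /andP[Mu uM].
  have u0 : 0 <= (u + M) / eta by rewrite divr_ge0 ?(ltW eta0)//; lra.
  have /andP[h1 h2] := truncn_itv u0.
  rewrite -ler_pdivlMr// -ltr_pdivrMr// h1 h2; split => //.
  rewrite ltnS; apply: le_truncn.
  by rewrite ler_wpM2r ?invr_ge0 ?(ltW eta0)//; lra.
have [sL /andP[s1 s2]] := pP s sM; have [tL /andP[t1 t2]] := pP t tM.
move=> /(congr1 val); rewrite /= !inordK// => st.
move: s1 s2 t1 t2; rewrite st -natr1 mulrDl mul1r.
move: (_%:R * eta) => w; rewrite ler_norml => *.
by apply/andP; split; lra.
Qed.

(** * The averaging operator as a bounded integral operator on L^1 *)

Section averaging.
Context {R : realType} {X : pmetricType R}.
Variable mu : {outer_measure set X -> \bar R}.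
Hypothesis mu_borel : borel_measurable mu.
Hypothesis mu_ball : forall (x : X) (s : R), 0 < s ->
  (0%E < mu (cball x s) < +oo)%E.
Hypothesis mu_doubling : forall s : R, 0 < s -> doubling mu s.
Variable r : R.
Hypothesis r_gt0 : 0 < r.

Local Notation T := (caratheodory_type mu).
Local Notation m := (cara_measure mu).

Let V (x : X) := fine (mu (cball x r)).
Let V_gt0 x : 0 < V x. Proof. exact: fine_cball_gt0. Qed.
Let sfm : sigma_finite setT m. Proof. exact: sigma_finite_cara. Qed.

(** The indicator is taken on the product space so that joint measurability follows from that of the
    distance relation. *)
Definition ball_kernel (z : T * T) : R :=
  (fine (mu (cball (z.1 : X) r)))^-1 *
  \1_[set z : T * T | mdist (z.1 : X) z.2 <= r] z.

Local Notation K := ball_kernel.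

Let mD : measurable [set z : T * T | mdist (z.1 : X) z.2 <= r].
Proof. exact: measurable_mdist_le. Qed.

Lemma ball_kernelE (x y : T) : K (x, y) = (V x)^-1 * \1_(cball (x : X) r) y.
Proof. by rewrite /ball_kernel !indicE; congr (_ * (_ : bool)%:R). Qed.

(** The form suited to integration in [x] with [y] fixed. *)
Lemma ball_kernel_symE (x y : T) : K (x, y) = (V x)^-1 * \1_(cball (y : X) r) x.
Proof.
rewrite ball_kernelE !indicE; congr (_ * (_ : bool)%:R).
by apply/idP/idP; rewrite !inE /cball/= metric_sym.
Qed.

Lemma ball_kernel_ge0 z : 0 <= K z.
Proof.
apply: mulr_ge0; last by rewrite indicE.
by rewrite invr_ge0; exact/ltW/V_gt0.
Qed.

Lemma ball_kernel_le (x y : T) : K (x, y) <= (V x)^-1.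
Proof.
rewrite ball_kernelE ler_piMr// invr_ge0; exact/ltW/V_gt0.
Qed.

Lemma measurable_ball_kernel : measurable_fun setT K.
Proof.
apply: measurable_funM; last exact: measurable_indic.
apply: (@measurableT_comp _ _ _ _ _ _ (fun x : T => (V x)^-1)) => //.
(* The measure of [cball x r] is the integral of a section of a measurable set, hence measurable in
   [x]; the inverse is written as a power to stay measurable. *)
rewrite (_ : (fun _ => _) =
    (fun x : T => (\int[m]_y
      \1_[set z : T * T | mdist (z.1 : X) z.2 <= r] (x, y))
      `^ (- 1))); last first.
  apply/funext => x; rewrite powR_inv1.
    congr (_^-1); rewrite /Rintegral.
    rewrite (eq_integral (fun y : T => (\1_(cball (x : X) r) y)%:E)).
      by rewrite integral_indic ?setIT//; exact: measurable_cball.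
    by move=> y _; rewrite !indicE; congr ((_ : bool)%:R%:E).
  by apply: Rintegral_ge0 => y _; rewrite indicE.
apply: (measurableT_comp (measurable_powR _)).
apply: measurable_fun_Rintegral => //; exact: measurable_indic.
Qed.

(** If [x] is within [r] of [y], then [cball y r] lies in [cball x (2 * r)], so doubling gives
    [V y <= C * V x] and the kernel is at most [C / V y] on [cball y r]. *)
Lemma ball_kernel_schur : exists2 C : R, 0 < C &
  forall y, (\int[m]_x `|(K (x, y))%:E| <= C%:E)%E.
Proof.
have [C C1 CP] := mu_doubling r_gt0; have C0 : 0 < C by lra.
exists C => // y.
apply: (@le_trans _ _ (\int[m]_x ((C / V y)%:E * (\1_(cball (y : X) r) x)%:E))%E).
  apply: ge0_le_integral => //.
  - apply: measurableT_comp => //; apply/measurable_EFinP.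
    exact: (measurableT_comp measurable_ball_kernel).
  - apply/measurable_funeM/measurable_EFinP/measurable_indic.
    exact: measurable_cball.
  - move=> x _; rewrite abse_EFin ger0_norm ?ball_kernel_ge0// -EFinM lee_fin.
    rewrite ball_kernel_symE indicE.
    have [|_] := boolP (_ \in _); last by rewrite !mulr0.
    rewrite inE /cball/= => yx; rewrite !mulr1 ler_pdivlMr// mulrC ler_pdivrMr//.
    rewrite -lee_fin EFinM !fineK ?cball_fin_num//.
    apply: le_trans (CP x); apply: le_outer_measure; apply: sub_cball.
    by rewrite metric_sym; lra.
have CV0 : (0 <= (C / V y)%:E)%E by rewrite lee_fin ltW// divr_gt0.
have mb : measurable_fun setT (EFin \o (\1_(cball (y : X) r) : T -> R)).
  by apply/measurable_EFinP; apply: measurable_indic; exact: measurable_cball.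
rewrite ge0_integralZl//.
rewrite integral_indic ?setIT//; last exact: measurable_cball.
rewrite (_ : m _ = (V y)%:E); last by rewrite fineK// cball_fin_num.
by rewrite -EFinM lee_fin divfK// gt_eqF.
Qed.

Lemma averagingE (f : T -> R) (x : T) : m.-integrable setT (EFin \o f) ->
  averaging mu r f x = \int[m]_y (K (x, y) * f y).
Proof.
move=> intf; rewrite /averaging Rintegral_mkcond -RintegralZl//.
  apply: eq_Rintegral => y _; rewrite ball_kernelE -mulrA; congr (_ * _).
  by rewrite patchE indicE; case: (_ \in _); rewrite ?mul1r ?mul0r.
rewrite -restrict_EFin; apply: (integrable_mkcond _ _).1; first exact: measurable_cball.
by apply: integrableS intf => //; exact: measurable_cball.
Qed.

Lemma averaging_integrable (f : T -> R) : m.-integrable setT (EFin \o f) ->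
  m.-integrable setT (EFin \o (averaging mu r f : T -> R)).
Proof.
move=> intf; have /integrableP[/measurable_EFinP mf f_fin] := intf.
have [C C0 KC] := ball_kernel_schur.
rewrite (_ : _ \o _ = EFin \o (fun x => \int[m]_y (K (x, y) * f y))); last first.
  by apply/funext => x /=; rewrite averagingE.
apply/integrableP; split.
  apply/measurable_EFinP.
  apply: (measurable_fun_Rintegral sfm (g := fun z => K z * f z.2)).
  apply: measurable_funM; first exact: measurable_ball_kernel.
  exact: measurableT_comp.
apply: le_lt_trans (schur_bound sfm measurable_ball_kernel mf KC) _.
by rewrite lte_mul_pinfty// lee_fin ltW.
Qed.

Lemma integrable_kernel_mul (f : T -> R) (x : T) :
  m.-integrable setT (EFin \o f) ->
  m.-integrable setT (fun y => (K (x, y) * f y)%:E).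
Proof.
move=> intf; apply: (@integrable_bounded_mul _ _ _ _ _ _ (V x)^-1) => //.
  exact: (measurableT_comp measurable_ball_kernel).
by move=> y; rewrite ger0_norm ?ball_kernel_ge0// ball_kernel_le.
Qed.

Lemma averagingB (f g : T -> R) (x : T) :
  m.-integrable setT (EFin \o f) -> m.-integrable setT (EFin \o g) ->
  averaging mu r f x - averaging mu r g x =
  \int[m]_y (K (x, y) * (f y - g y)).
Proof.
move=> intf intg; rewrite !averagingE// -RintegralB//; last 2 first.
- exact: integrable_kernel_mul.
- exact: integrable_kernel_mul.
by apply: eq_Rintegral => y _; rewrite mulrBr.
Qed.

Lemma averaging_ae (f g : T -> R) (x : X) :
  measurable_fun setT f -> measurable_fun setT g -> ae_eq m setT f g ->
  averaging mu r f x = averaging mu r g x.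
Proof.
move=> mf mg fg; rewrite /averaging /Rintegral; congr (_ * fine _).
have mB : measurable (cball x r : set T) by exact: measurable_cball.
apply: ae_eq_integral => //.
- by apply/measurable_EFinP; exact: measurable_funS mf.
- by apply/measurable_EFinP; exact: measurable_funS mg.
- by apply: filterS fg => y /(_ I) -> _.
Qed.

(** * Normalized indicators of balls and their averages *)

Let bump (x : X) (s : R) (y : T) : R :=
  (fine (mu (cball x s)))^-1 * \1_(cball x s) y.

Let measurable_bump x s : measurable_fun setT (bump x s).
Proof.
apply: measurable_funM => //; apply: measurable_indic; exact: measurable_cball.
Qed.

Let bump_ge0 x s y : 0 <= bump x s y.
Proof.
by rewrite mulr_ge0// ?indicE// invr_ge0 fine_ge0// outer_measure_ge0.
Qed.

Let integral_bump x (s : R) : 0 < s -> (\int[m]_y (bump x s y)%:E = 1)%E.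
Proof.
move=> s0; have V0 := fine_cball_gt0 mu_ball x s0.
have mb : measurable (cball x s : set T) by exact: measurable_cball.
rewrite (eq_integral (fun y : T =>
  ((fine (mu (cball x s)))^-1)%:E * (\1_(cball x s) y)%:E)%E)//.
rewrite ge0_integralZl//; last 2 first.
- exact/measurable_EFinP/measurable_indic.
- by rewrite lee_fin invr_ge0 ltW.
rewrite integral_indic ?setIT//.
rewrite [X in (_ * X)%E](_ : _ = (fine (mu (cball x s)))%:E).
  by rewrite -EFinM mulVf ?gt_eqF.
by rewrite fineK// cball_fin_num.
Qed.

Let integrable_bump x (s : R) : 0 < s -> m.-integrable setT (EFin \o bump x s).
Proof.
move=> s0; apply/integrableP; split; first exact/measurable_EFinP.
under eq_integral do rewrite /= ger0_norm//.
by rewrite integral_bump// ltry.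
Qed.

Let averaging_bump x z (s : R) : 0 < s -> cball z s `<=` cball x r ->
  averaging mu r (bump z s) x = (fine (mu (cball x r)))^-1.
Proof.
move=> s0 sub; rewrite /averaging Rintegral_mkcond.
rewrite (@eq_Rintegral _ _ _ m _ (bump z s)) => [|y _].
  by rewrite /Rintegral integral_bump//= mulr1.
rewrite patchE; case: ifPn => // xy; rewrite /bump indicE memNset ?mulr0// => zy.
by move: xy; rewrite mem_set//; exact: sub.
Qed.

Let averaging_bump0 x z s : [disjoint cball z s & cball x r] ->
  averaging mu r (bump z s) x = 0.
Proof.
move=> /eqP/seteqP[dis _]; rewrite /averaging (@eq_Rintegral _ _ _ m _ (cst 0)) => [|y].
  by rewrite Rintegral_cst ?mul0r ?mulr0//; exact: measurable_cball.
rewrite inE => xy; rewrite /bump indicE memNset ?mulr0// => zy.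
exact: (dis y).
Qed.

(** * The operator on classes, and its compactness on a bounded space *)

Variable A : L1 mu -> L1 mu.
Hypothesis AE : forall f : L1 mu, ae_eq m setT (A f) (averaging mu r f).

Lemma averaging_mdistE (f g : L1 mu) : ((mdist (A f) (A g) : R)%:E =
  \int[m]_x `|(averaging mu r f x - averaging mu r g x)%:E|)%E.
Proof.
have [/integrableP[/measurable_EFinP mf _]] := (averaging_integrable (L1_integrable f)).
have [/integrableP[/measurable_EFinP mg _]] := (averaging_integrable (L1_integrable g)).
rewrite L1_mdistE; apply: ae_eq_integral => //.
- apply: measurableT_comp => //; apply/measurable_EFinP.
  by apply: measurable_funB; exact: L1_measurable.
- apply: measurableT_comp => //; apply/measurable_EFinP.
  exact: measurable_funB.
- by apply: filterS2 (AE f) (AE g) => x /= /(_ I) -> /(_ I) ->.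
Qed.

(** In [x], the difference is supported on the symmetric difference of the two balls, where its
    absolute value is [1 / V x], at most [1 / c]. *)
Lemma ball_kernel_diff (c : R) (y q : X) : 0 < c ->
  (forall x, (c%:E <= mu (cball x r))%E) ->
  (\int[m]_x `|(K (x, y) - K (x, q))%:E| <= (c^-1)%:E *
    mu (cball y r `\` cball q r `|` (cball q r `\` cball y r)))%E.
Proof.
move=> c0 cV; set D := _ `|` _.
have mD' : measurable (D : set T).
  by apply: measurableU; apply: measurableD; exact: measurable_cball.
have mDe : measurable_fun setT (EFin \o (\1_D : T -> R)).
  by apply/measurable_EFinP; exact: measurable_indic.
have cV0 : (0 <= (c^-1)%:E :> \bar R)%E by rewrite lee_fin invr_ge0 ltW.
apply: (@le_trans _ _ (\int[m]_x ((c^-1)%:E * (\1_D x)%:E))%E).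
  apply: ge0_le_integral => //.
  - apply: measurableT_comp => //; apply/measurable_EFinP.
    have mK := measurable_ball_kernel.
    by apply: measurable_funB; exact: (measurableT_comp mK).
  - exact: measurable_funeM.
  move=> x _; rewrite abse_EFin -EFinM lee_fin !ball_kernel_symE -mulrBr.
  have V0 : 0 < fine (mu (cball x r)) by exact: fine_cball_gt0.
  rewrite normrM ger0_norm ?invr_ge0 ?(ltW V0)//; apply: ler_pM => //.
  - by rewrite invr_ge0 ltW.
  - rewrite lef_pV2 ?posrE//.
    by rewrite -lee_fin fineK// cball_fin_num.
  rewrite !indicE; have [xy|xy] := boolP (x \in cball y r);
    have [xq|xq] := boolP (x \in cball q r).
  - by rewrite subrr normr0.
  - rewrite subr0 normr1 mem_set//; left.
    by split; [exact/set_mem|move: xq; rewrite notin_setE].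
  - rewrite sub0r normrN normr1 mem_set//; right.
    by split; [exact/set_mem|move: xy; rewrite notin_setE].
  - by rewrite subrr normr0.
rewrite ge0_integralZl// integral_indic ?setIT//.
Qed.

(** Members of [S] are coloured by their rounded integrals over the cells, relative to a base
    element [f0]. Equal colours bound the distance of the images by [eps * B] from the kernel error
    plus [C * N * eta] from the rounding, each at most [e / 2]. *)
Theorem bounded_compact_averaging : star mu r -> metric_bounded [set: X] ->
  compact_operator A.
Proof.
move=> mu_star [M0 M0P] S [B0 B0P].
pose M := Num.max M0 1.
have MP (x y : X) : mdist x y <= M by rewrite le_max M0P.
have M_gt0 : 0 < M by rewrite lt_max ltr01 orbT.
pose B := Num.max B0 1.
have BP f g : S f -> S g -> mdist f g <= B by move=> *; rewrite le_max B0P.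
have B_gt0 : 0 < B by rewrite lt_max ltr01 orbT.
have [->|/set0P[_ [f0 Sf0 _]]] := eqVneq (A @` S) set0.
  by rewrite precompactE closure0; exact: compact0.
have [c c0 cP] := cball_measure_lbound mu_ball mu_doubling
  (point : X) M r_gt0.
have cV x : (c%:E <= mu (cball x r))%E by exact: cP.
have [C C0 KC] := ball_kernel_schur.
apply: colouring_precompact; first exact: L1_fast_cauchy_cvg.
move=> e e0.
pose eps := e / (2 * B); have eps0 : 0 < eps by rewrite divr_gt0// mulr_gt0.
(* The factor [c] cancels the [1 / c] of [ball_kernel_diff]. *)
have [delta delta0 deltaP] := star_diff mu_star (mulr_gt0 c0 eps0).
have [s sP] := cball_finite_net mu_borel mu_ball mu_doubling
  (point : X) M_gt0 delta0.
pose N := size s; pose q i : X := nth point s i.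
(* Making the net balls disjoint leaves exactly one nonzero term at each [y] in the finite rank
   kernel. *)
pose E (i : 'I_N) : set T := seqDU (fun j => cball (q j) delta) i.
have mE i : measurable (E i).
  by apply: seqDU_measurable => j; exact: measurable_cball.
have Ecover y : exists i : 'I_N, [/\ E i y, mdist (q i) y <= delta &
    forall j, j != i -> ~ E j y].
  have [z zs zy] := sP y (MP _ _).
  have : (\big[setU/set0]_(i < N) cball (q i) delta) y.
    rewrite -(bigcup_mkord N (fun j => cball (q j) delta)).
    exists (index z s); first by rewrite /= index_mem.
    by rewrite /q nth_index.
  rewrite (bigsetU_seqDU (fun j => cball (q j) delta)).
  rewrite -(bigcup_mkord N (seqDU _)) => -[i /= iN Eiy].
  exists (Ordinal iN); split => //.
    by have := subset_seqDU Eiy.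
  move=> j /eqP ji Ejy; apply: ji; apply: val_inj => /=.
  apply: (@trivIset_seqDU _ (fun j => cball (q j) delta)) => //.
  by exists y.
pose k (i : 'I_N) (x : T) := K (x, q i).
have mK := measurable_ball_kernel.
have mk i : measurable_fun setT (k i) by exact: (measurableT_comp mK).
have Kb (x : T) : exists b, forall y, `|K (x, y)| <= b.
  exists (fine (mu (cball (x : X) r)))^-1 => y.
  by rewrite ger0_norm ?ball_kernel_ge0// ball_kernel_le.
have Keps (y : T) :
    (\int[m]_x `|(K (x, y) - \sum_i k i x * \1_(E i) y)%:E| <= eps%:E)%E.
  have [i [Eiy iy Ej]] := Ecover y.
  rewrite (eq_integral (fun x => `|(K (x, y) - K (x, q i))%:E|%E)); last first.
    move=> x _; rewrite (bigD1 i)//= big1 ?addr0 => [|j ji].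
      by rewrite indicE mem_set// mulr1.
    by rewrite indicE memNset ?mulr0//; exact: Ej.
  apply: (le_trans (ball_kernel_diff y (q i) c0 cV)).
  rewrite lee_pdivrMl// -EFinM ltW// deltaP//.
  by rewrite metric_sym.
pose a (i : 'I_N) (f g : L1 mu) := \int[m]_y (\1_(E i) y * (f y - g y)).
have ifg (f g : L1 mu) : m.-integrable setT (EFin \o (fun y => f y - g y)).
  exact: (integrableB measurableT (L1_integrable f) (L1_integrable g)).
have iE i (f g : L1 mu) :
    m.-integrable setT (EFin \o (fun y => \1_(E i) y * (f y - g y))).
  apply: (@integrable_bounded_mul _ _ _ _ _ _ 1) => // y.
  by rewrite indicE; case: (_ \in _); rewrite ?normr1 ?normr0.
have aB i f g : S f -> S g -> `|a i f g| <= B.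
  move=> Sf Sg; apply: le_trans (BP _ _ Sf Sg).
  rewrite -lee_fin L1_mdistE EFin_normr_Rintegral//.
  apply: le_trans (le_abse_integral _ _ _) _ => //.
    by have /integrableP[] := iE i f g.
  apply: ge0_le_integral => //.
  - by apply: measurableT_comp => //; have /integrableP[] := iE i f g.
  - by apply: measurableT_comp => //; have /integrableP[] := ifg f g.
  move=> y _; rewrite !abse_EFin lee_fin normrM ler_piMl//.
  by rewrite indicE; case: (_ \in _); rewrite ?normr1 ?normr0.
have aD i f g : a i f f0 - a i g f0 = a i f g.
  rewrite /a -RintegralB//; apply: eq_Rintegral => y _.
  by rewrite -mulrBr opprB addrA subrK.
(* [N.+1] in place of [N] keeps the denominator positive without a case on the net being empty. *)
pose eta := e / (2 * C * N.+1%:R).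
have eta0 : 0 < eta by rewrite divr_gt0// !mulr_gt0.
have [L [b bP]] := finite_colouring_itv B eta0.
(* An image is coloured through one chosen preimage; outside the image the value [f0] is a dummy. *)
have /choice[p pP] : forall F, exists f, (A @` S) F -> S f /\ A f = F.
  move=> F; have [[f Sf <-]|] := pselect ((A @` S) F); last by exists f0.
  by exists f.
exists {ffun 'I_N -> 'I_L.+1}, (fun F => [ffun i => b (a i (p F) f0)]).
move=> F G /pP[Sf AF] /pP[Sg AG] /ffunP fg; rewrite -AF -AG.
move: (p F) (p G) Sf Sg fg => f g Sf Sg fg.
rewrite -lee_fin averaging_mdistE.
under eq_integral do rewrite (averagingB)
  ?L1_integrable//.
apply: le_trans (finite_rank_approx sfm mK Kb mk mE Keps (fun i => KC _) (ifg f g)) _.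
rewrite -L1_mdistE -EFinM -EFinD lee_fin [leRHS]splitr lerD//.
  apply: (@le_trans _ _ (eps * B)); first by rewrite ler_wpM2l ?BP ?(ltW eps0).
  by rewrite /eps invfM mulrA divfK ?gt_eqF.
apply: (@le_trans _ _ (C * \sum_(i < N) eta)).
  rewrite ler_wpM2l ?(ltW C0)//; apply: ler_sum => i _.
  rewrite -/(a i f g) -aD; apply: bP; [exact: aB|exact: aB|].
  by have := fg i; rewrite !ffunE.
rewrite sumr_const card_ord.
apply: (@le_trans _ _ (C * (eta *+ N.+1))).
  by rewrite ler_wpM2l ?(ltW C0)// ler_wpMn2l ?(ltW eta0).
have N0 : N.+1%:R != 0 :> R by [].
rewrite -[eta *+ _]mulr_natr (_ : C * _ = e / 2)// /eta.
by move: N.+1%:R N0 => w w0; field; rewrite w0 gt_eqF.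
Qed.

(** * Failure of compactness on an unbounded space *)

Theorem compact_averaging_bounded : compact_operator A ->
  metric_bounded [set: X].
Proof.
move=> cA; apply: contrapT => unb.
have r20 : 0 < r / 2 by rewrite divr_gt0.
(* For [x] in [cball (u i) (r / 2)], the ball [cball x r] reaches at most [3 / 2 * r] from [u i], so
   it misses [cball (u j) (r / 2)]. *)
have [u usep] := unbounded_separated (point : X) (4 * r) unb.
pose f n := bump (u n) (r / 2).
have /choice[F FP] : forall n, exists F : L1 mu, ae_eq m setT F (f n).
  by move=> n; exact: L1_class (integrable_bump (u n) r20).
have normF n : (\int[m]_x `|(F n x)%:E| = 1)%E.
  rewrite -[RHS](integral_bump (u n) r20); apply: ae_eq_integral => //.
  - exact/measurableT_comp/measurable_EFinP/L1_measurable.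
  - exact/measurable_EFinP.
  - by apply: filterS (FP n) => x /= /(_ I) -> _; rewrite ger0_norm//; exact: bump_ge0.
have avF n x : averaging mu r (F n) x = averaging mu r (f n) x.
  apply: averaging_ae (FP n); [exact: L1_measurable|exact: measurable_bump].
have bF : metric_bounded (range F).
  exists 2 => _ _ [i _ <-] [j _ <-].
  rewrite -lee_fin L1_mdistE.
  rewrite (_ : 2%:E = \int[m]_x `|(F i x)%:E| + \int[m]_x `|(F j x)%:E|)%E; last first.
    by rewrite !normF.
  rewrite -ge0_integralD//; last 2 first.
  - exact/measurableT_comp/measurable_EFinP/L1_measurable.
  - exact/measurableT_comp/measurable_EFinP/L1_measurable.
  apply: ge0_le_integral => //.
  - apply: measurableT_comp => //; apply/measurable_EFinP.
    by apply: measurable_funB; exact: L1_measurable.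
  - apply: emeasurable_funD; exact/measurableT_comp/measurable_EFinP/L1_measurable.
  - by move=> x _; rewrite -EFinD lee_fin ler_normB.
(* Two doublings lead from radius [r / 2] to [2 * r], enough for the ball about [u i] to contain
   [cball x r]. *)
have [g g0 gP] := doubling_iter mu_doubling 2 r20.
have V0 (x : X) s := @fine_cball_gt0 _ _ _ mu_ball x s.
have [i [j [ij]]] := @precompact_close_terms _ _ _ (A \o F) _ (cA _ bF)
  (fun n => imageP A (imageT F n)) (divr_gt0 ltr01 g0 : 0 < 1 / g).
apply/negP; rewrite -leNgt /= -lee_fin averaging_mdistE.
pose B := cball (u i) (r / 2) : set T.
have mB : measurable B by exact: measurable_cball.
have mav n : measurable_fun setT (averaging mu r (F n) : T -> R).
  by have /integrableP[/measurable_EFinP] := averaging_integrable (L1_integrable (F n)).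
(* Writing [1 / g] as an integral reduces the lower bound to a pointwise one, trivial off [B]; on
   [B] it says that [V x] is at most [g] times the measure of [B]. *)
rewrite (_ : (1 / g)%:E = \int[m]_x ((g^-1)%:E * (f i x)%:E))%E; last first.
  have mf : measurable_fun setT (EFin \o f i).
    by apply/measurable_EFinP; exact: measurable_bump.
  have g0' : (0 <= (g^-1)%:E :> \bar R)%E by rewrite lee_fin invr_ge0 ltW.
  rewrite (ge0_integralZl m measurableT mf)//.
    by rewrite integral_bump// mule1 div1r.
  by move=> x _; rewrite lee_fin; exact: bump_ge0.
apply: ge0_le_integral => //.
- move=> x _; rewrite -EFinM lee_fin mulr_ge0//; last exact: bump_ge0.
  by rewrite invr_ge0 ltW.
- apply: measurable_funeM; apply/measurable_EFinP; exact: measurable_bump.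
- by apply: measurableT_comp => //; apply/measurable_EFinP; exact: measurable_funB.
move=> x _; rewrite abse_EFin -EFinM lee_fin !avF.
have [xB|xB] := boolP (x \in B); last first.
  by rewrite /f /bump indicE (negbTE xB) !mulr0.
have := set_mem xB; rewrite /B /cball/= => ux.
rewrite averaging_bump//; last first.
  by apply: sub_cball; rewrite metric_sym; lra.
rewrite averaging_bump0; last first.
  apply/eqP/seteqP; split => // y [/=]; rewrite /cball/= => uy xy.
  have := usep _ _ ij; have := metric_triangle (u i) y (u j).
  by have := metric_triangle (u i) x y; rewrite (metric_sym y (u j)); lra.
rewrite subr0 ger0_norm ?invr_ge0 ?(ltW (V0 _ _ _))//.
rewrite /f /bump indicE xB mulr1 -invfM lef_pV2 ?posrE ?mulr_gt0 ?V0//.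
rewrite -lee_fin EFinM !fineK ?cball_fin_num//.
apply: le_trans (gP (u i)); apply: le_outer_measure; apply: sub_cball.
by rewrite expr2; lra.
Qed.

End averaging.

(** * Construction of the operator on classes, and the equivalence *)

Theorem theorem1p1 (R : realType) (X : pmetricType R)
    (mu : {outer_measure set X -> \bar R})
    (mu_borel : borel_measurable mu)
    (mu_regular : borel_regular mu)
    (mu_ball : forall (x : X) (s : R), 0 < s ->
      (0%E < mu (cball x s) < +oo)%E)
    (r : R) (r_gt0 : 0 < r)
    (mu_doubling_star : forall s : R, 0 < s -> doubling mu s /\ star mu s) :
  exists2 A : L1 mu -> L1 mu,
    forall f : L1 mu, ae_eq (cara_measure mu) setT (A f) (averaging mu r f) &
    compact_operator A <-> metric_bounded [set: X].
Proof.
have mu_doubling s (s0 : 0 < s) := (mu_doubling_star s s0).1.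
(* Averages of integrable functions are integrable by Schur's test, so each has a class, and choice
   turns these classes into a map. *)
have /choice[A AE] : forall f : L1 mu, exists F : L1 mu,
    ae_eq (cara_measure mu) setT F (averaging mu r f).
  move=> f; apply: L1_class.
  exact: (averaging_integrable mu_borel mu_ball mu_doubling r_gt0 (L1_integrable f)).
exists A => //; split.
  exact: (compact_averaging_bounded mu_borel mu_ball mu_doubling r_gt0 AE).
apply: (bounded_compact_averaging mu_borel mu_ball mu_doubling r_gt0 AE).
exact: (mu_doubling_star r r_gt0).2.
Qed.
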